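(* Let $\{\xi_n\}_{n\ge1}$ be a sequence of i.i.d. random variables whose common distribution satisfies $\mathbb{E}|\xi_1|<\infty$ and $$\lim_{u\rightarrow\infty}u^{-p}\log\mathbb{P}\left\{|\xi_1|\geq u\right\}=-c$$ for some constants $p\geq1$ and $0<c<\infty$. Let $q$ be given by $\frac1p+\frac1q=1$, and suppose that a sequence of positive real numbers $\{a_n\}_{n\ge1}$ is such that $\sum_{n=1}^{\infty}a_n^{2\wedge q}<\infty$. Then, as $r\rightarrow\infty$, $$\log\mathbb{P}\left\{\sum_{n=1}^{\infty}a_n|\xi_n|\geq r\right\}\sim -r^p\cdot c\cdot \|a\|_q^{-p}.$$
   Context: Here $2\wedge q=\min\{2,q\}$, and $q=\infty$ when $p=1$. For a real sequence $a=\{a_n\}$, $\|a\|_q=\left(\sum_{n=1}^{\infty}a_n^q\right)^{1/q}$ for finite $q$, and $\|a\|_\infty=\max_n|a_n|$. The notation $F(r)\sim G(r)$ as $r\to\infty$ means $F(r)/G(r)\to1$ as $r\to\infty$.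
   Formalization: The formal theorem additionally assumes that the series of a_n|ξ_n| converges almost surely; without this the claim fails, e.g. a_n = 1/n with Gaussian ξ_n and p = q = 2, where the series is a.s. infinite and the log-probability is 0. *)

(* Defs.v *)
From HB Require Import structures.
From mathcomp Require Import all_boot all_order all_algebra.
From mathcomp Require Import finmap.
From mathcomp Require Import all_classical all_reals all_analysis.

Set Implicit Arguments.
Unset Strict Implicit.
Unset Printing Implicit Defensive.
Import Order.TTheory GRing.Theory Num.Theory.
Import numFieldNormedType.Exports.

Local Open Scope classical_set_scope.
Local Open Scope ring_scope.
Local Open Scope ereal_scope.

Definition mutually_independent (R : realType) (d : measure_display)
    (T : measurableType d) (P : probability T R) (X : nat -> {RV P >-> R}) :
    Prop :=
  forall (J : {fset nat}) (B : nat -> set R),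
    (forall i, measurable (B i)) ->
    P (\bigcap_(i in [set` J]) X i @^-1` B i) =
    \prod_(i <- J) P (X i @^-1` B i).

Definition identically_distributed (R : realType) (d : measure_display)
    (T : measurableType d) (P : probability T R) (X : nat -> {RV P >-> R}) :
    Prop :=
  forall (n : nat) (B : set R), measurable B ->
    distribution P (X n) B = distribution P (X 0%N) B.

(* For q = +oo this is a supremum; it is a maximum as soon as a tends to 0,
   in particular when some sum of positive powers of |a_n| converges.
   The value at q = -oo is a dummy. *)
Definition seq_norm (R : realType) (q : \bar R) (a : nat -> R) : \bar R :=
  match q with
  | s%:E => (\sum_(0 <= n <oo) (`|a n| `^ s)%:E) `^ s^-1
  | +oo => ereal_sup (range (fun n => `|a n|%:E))
  | -oo => 0
  end.

Definition asymp_equiv_pinfty (R : realType) (F G : R -> \bar R) : Prop :=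
  (fun r => F r / G r) @ +oo%R --> 1.

(* Main.v *)
Require Import Defs.
From HB Require Import structures.
From mathcomp Require Import all_boot all_order all_algebra.
From mathcomp Require Import finmap ring lra.
From mathcomp Require Import all_classical all_reals all_analysis.
From mathcomp Require Import measurable_realfun.

Set Implicit Arguments.
Unset Strict Implicit.
Unset Printing Implicit Defensive.
Import Order.TTheory GRing.Theory Num.Theory.
Import numFieldNormedType.Exports.

Local Open Scope classical_set_scope.
Local Open Scope ring_scope.
Local Open Scope ereal_scope.

(** Write X_n = |xi_n|, S = sum_n a_n X_n and N for the q-norm of a.  The cheapest
way for S to reach the level r is that each X_n reaches some level r x_n with
sum_n a_n x_n = 1; this costs about c r^p sum_n x_n^p, and by the duality of the
p-norm and the q-norm the least value of sum_n x_n^p is N^(-p).  Both bounds below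
turn this into a proof.

Lower bound ([lower_tail_bound]).  Finitely many coordinates x_i nearly attain the
minimum ([primal_norm_witness]), and by independence the probability that
X_i >= r x_i for all of them is a product, to which the tail of X_0 applies.

Upper bound ([upper_tail_bound]).  The Chernoff inequality requires the exponential
moments of l a_n X_n.  Duality is used in the form of certificates b_n such that
l a_n x <= k x^p + b_n for all x >= 0, with k < c close to c
([dual_norm_bound]); for p > 1 this is the Young inequality.  As exp (k X^p) is
integrable ([exp_moment_lty]), the certificate gives
E exp (l a_n X_n) <= exp (b_n) E exp (k X^p), but the last factor cannot be
multiplied over infinitely many n.  When l a_n is small it can be replaced by
1 + O(l a_n), and when l a_n is not small the constant is itself at most
exp (O(l a_n)); so in all cases E exp (l a_n X_n) <= exp (b_n + K l a_n)
([mgf_le_of_young]).  The product over n is finite once sum_n a_n is, and with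
l of order r^(p-1) the extra term K l sum_n a_n is of order r^(p-1), negligible
against r^p.

That sum_n a_n is finite follows from the almost sure convergence of S
([summable_weights]): the Laplace transform of a partial sum is at most
exp (- h sum_(n < m) a_n) for some h > 0, so divergence of sum_n a_n would force
S to be infinite almost surely.

The product formula for expectations of independent variables, on which all of
this relies, is derived from its version for events
([expectation_prod_independent]). *)

(** * Expectations of products of independent variables *)

Section product.
Context (R : realType) (d : measure_display) (T : measurableType d)
  (P : probability T R).
Implicit Types X : {RV P >-> R}.

Lemma measurable_comp_RV X (f : R -> R) :
  measurable_fun setT f -> measurable_fun setT (fun w => f (X w)).
Proof. by move=> mf; apply: measurableT_comp. Qed.

Lemma measurable_preimage_RV X (B : set R) :
  measurable B -> measurable (X @^-1` B).
Proof. by move=> mB; rewrite -[_ @^-1` _]setTI; apply: measurable_funP. Qed.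

Lemma expectation_indic_comp X (B : set R) : measurable B ->
  \int[P]_w (\1_B (X w))%:E = P (X @^-1` B).
Proof.
move=> mB; have := integral_indic P measurableT (measurable_preimage_RV X mB).
by rewrite setIT.
Qed.

Import HBNNSimple.

(** Linearity reduces the integral of a simple function of X, weighted by g, to the
integrals of indicators of X. *)
Lemma nnsfun_comp_integralM X (h : {nnsfun R >-> R}) (g : T -> R) :
  measurable_fun setT g -> (forall w, (0 <= g w)%R) ->
  \int[P]_w (h (X w) * g w)%:E =
  \sum_(y \in range h) y%:E * \int[P]_w (\1_(h @^-1` [set y]) (X w) * g w)%:E.
Proof.
move=> mg g0.
transitivity (\int[P]_w (\sum_(y \in range h)
    (y%:E * (\1_(h @^-1` [set y]) (X w) * g w)%:E))).
  apply: eq_integral => w _.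
  rewrite (fimfunE h (X w)) EFinM -fsumEFin// ge0_mule_fsuml//.
    by apply: eq_fsbigr => y _; rewrite -!EFinM mulrA.
  by move=> y; exact: nnfun_muleindic_ge0.
have m1 (y : R) : measurable_fun [set: T]
    (fun w => (\1_(h @^-1` [set y]) (X w) * g w)%:E).
  apply/measurable_EFinP; apply: measurable_funM => //.
  by apply: measurable_comp_RV; exact: measurable_indic.
have g1 (y : R) w : 0 <= (\1_(h @^-1` [set y]) (X w) * g w)%:E.
  by rewrite lee_fin mulr_ge0.
rewrite ge0_integral_fsum//.
- apply: eq_fsbigr => y /[!inE] -[x _ <-].
  by rewrite ge0_integralZl_EFin// fun_ge0.
- by move=> y; apply: measurable_funeM.
- move=> y w _; have [[x _ <-]|yN] := pselect (range h y).
    by rewrite mule_ge0// lee_fin.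
  rewrite preimage10 ?indic0//; by rewrite mul0r mule0.
Qed.

(** The sets B and the functions f are tied by the two measures
B |-> E [1_B(X) g_i] on the line: if they agree on all B, then they have the same
integrals, by approximation of f from below by simple functions. *)
Lemma eq_integral_comp_mul X (g1 g2 : T -> R) (f : R -> R) :
  measurable_fun setT g1 -> (forall w, (0 <= g1 w)%R) ->
  measurable_fun setT g2 -> (forall w, (0 <= g2 w)%R) ->
  (forall B, measurable B ->
    \int[P]_w (\1_B (X w) * g1 w)%:E = \int[P]_w (\1_B (X w) * g2 w)%:E) ->
  measurable_fun setT f -> (forall x, (0 <= f x)%R) ->
  \int[P]_w (f (X w) * g1 w)%:E = \int[P]_w (f (X w) * g2 w)%:E.
Proof.
move=> mg1 g10 mg2 g20 g12 mf f0.
have mfE : measurable_fun setT (EFin \o f) by exact/measurable_EFinP.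
pose h := nnsfun_approx measurableT mfE.
have lim_h (g : T -> R) : measurable_fun setT g -> (forall w, (0 <= g w)%R) ->
    \int[P]_w (f (X w) * g w)%:E = limn (fun n => \int[P]_w (h n (X w) * g w)%:E).
  move=> mg g0; rewrite -monotone_convergence//=.
  - apply: eq_integral => w _; apply/esym/cvg_lim => //.
    under eq_fun do rewrite EFinM.
    rewrite EFinM; apply: cvgeZr => //.
    by apply: (@cvg_nnsfun_approx _ _ _ _ measurableT _ mfE) => // x _;
      rewrite lee_fin.
  - move=> n; apply/measurable_EFinP; apply: measurable_funM => //.
    exact: measurable_comp_RV.
  - by move=> n w _; rewrite lee_fin mulr_ge0.
  - move=> w _ m n mn; rewrite lee_fin ler_wpM2r//.
    exact/lefP/nd_nnsfun_approx.
rewrite lim_h// lim_h//; congr (limn _); apply/funext => n.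
rewrite !nnsfun_comp_integralM//; apply: eq_fsbigr => y _.
by rewrite g12.
Qed.

Lemma independent_prod_preimage (X : nat -> {RV P >-> R}) (N : nat) (B : nat -> set R) :
  mutually_independent X -> (forall i, measurable (B i)) ->
  P [set w | forall i, (i < N)%N -> B i (X i w)] =
  \prod_(i < N) P (X i @^-1` B i).
Proof.
move=> ind mB.
have := ind [fset i in iota 0 N]%fset B mB.
rewrite (perm_big (index_iota 0 N)); last first.
  apply: uniq_perm; rewrite ?fset_uniq ?iota_uniq// => i.
  by rewrite !inE mem_iota mem_index_iota.
rewrite big_mkord => <-.
congr (P _); apply/seteqP; split=> [w Bw i /=|w Bw i iN].
  by rewrite !inE mem_iota/= add0n; exact: Bw.
by apply: Bw => /=; rewrite !inE mem_iota/= add0n.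
Qed.

Lemma prod_indic_preimage (X : nat -> {RV P >-> R}) (N : nat) (B : nat -> set R) w :
  (\prod_(i < N) \1_(B i) (X i w) =
  \1_[set w | forall i, (i < N)%N -> B i (X i w)] w :> R)%R.
Proof.
rewrite [RHS]indicE; case: (boolP (w \in _)) => [/set_mem /= Bw|/negP Bw].
  by rewrite big1// => i _; rewrite indicE mem_set//; exact: Bw.
have [[i Bi]|Bi] := pselect (exists i : 'I_N, ~ B i (X i w)).
  by rewrite (bigD1 i)//= indicE memNset// mul0r.
exfalso; apply: Bw; apply/mem_set => /= i iN.
apply: contrapT => nB; apply: Bi; by exists (Ordinal iN).
Qed.

(** Induction on the number k of factors allowed to be arbitrary, the others being
indicators.  For k = 0 the formula is mutual independence.  Given the formula for k,
let B vary in the k-th factor: it says that the remaining factors g, as a density for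
the law of the k-th variable, cannot be told from the constant
C = the product of the other expectations; hence neither can they be when the k-th
factor is any nonnegative function. *)
Lemma expectation_prod_independent (X : nat -> {RV P >-> R}) (N : nat)
    (F : nat -> R -> R) :
  mutually_independent X ->
  (forall i, measurable_fun setT (F i)) -> (forall i x, (0 <= F i x)%R) ->
  (forall i, \int[P]_w (F i (X i w))%:E < +oo) ->
  \int[P]_w (\prod_(i < N) F i (X i w))%:E =
  \prod_(i < N) \int[P]_w (F i (X i w))%:E.
Proof.
move=> ind.
suff H k : forall F : nat -> R -> R,
  (forall i, measurable_fun setT (F i)) -> (forall i x, (0 <= F i x)%R) ->
  (forall i, \int[P]_w (F i (X i w))%:E < +oo) ->
  (forall i, (k <= i)%N -> (i < N)%N -> exists2 B, measurable B & F i = \1_B) ->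
  \int[P]_w (\prod_(i < N) F i (X i w))%:E =
  \prod_(i < N) \int[P]_w (F i (X i w))%:E.
  by move=> mF F0 Foo; apply: (H N) => // i Ni; rewrite ltnNge Ni.
elim: k => [|k IH] {}F mF F0 Foo FB.
  have {}FB i : exists B, measurable B /\ ((i < N)%N -> F i = \1_B).
    have [iN|] := boolP (i < N)%N; last by exists set0; split => //.
    by have [B mB FB'] := FB i isT iN; exists B.
  have [B HB] := choice FB.
  have mD : measurable [set w | forall i, (i < N)%N -> B i (X i w)].
    rewrite (_ : [set _ | _] = \bigcap_(i in `I_N) (X i @^-1` B i)).
      apply: bigcap_measurableType => i _.
      by apply: measurable_preimage_RV; exact: (HB i).1.
    by apply/seteqP; split => w Bw i; apply: Bw.
  transitivity (\int[P]_w
      (\1_[set w | forall i, (i < N)%N -> B i (X i w)] w)%:E).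
    apply: eq_integral => w _; rewrite -prod_indic_preimage; congr EFin.
    by apply: eq_bigr => i _; rewrite (HB i).2.
  rewrite integral_indic// setIT.
  apply: etrans (independent_prod_preimage N ind _) _ => [i|].
    exact: (HB i).1.
  apply: eq_bigr => i _; rewrite (HB i).2//.
  by rewrite expectation_indic_comp//; exact: (HB i).1.
have [kN|Nk] := ltnP k N; last first.
  by apply: IH => // i ki iN; exfalso; move: (leq_ltn_trans ki iN); rewrite ltnNge Nk.
pose o := Ordinal kN.
pose g w := (\prod_(i < N | i != o) F i (X i w))%R.
pose C := (\prod_(i < N | i != o) fine (\int[P]_w (F i (X i w))%:E))%R.
have EF0 i : 0 <= \int[P]_w (F i (X i w))%:E.
  by apply: integral_ge0 => w _; rewrite lee_fin.
have fC : C%:E = \prod_(i < N | i != o) \int[P]_w (F i (X i w))%:E.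
  rewrite /C -prodEFin; apply: eq_bigr => i _.
  by rewrite fineK// ge0_fin_numE.
have C0 : (0 <= C)%R by apply: prodr_ge0 => i _; exact: fine_ge0.
have g0 w : (0 <= g w)%R by apply: prodr_ge0.
have mg : measurable_fun setT g.
  rewrite /g; under eq_fun do rewrite -big_filter.
  by apply: measurable_prod => i _; exact: measurable_comp_RV.
have mFk := mF k.
transitivity (\int[P]_w (F k (X k w) * g w)%:E).
  by apply: eq_integral => w _; rewrite (bigD1 o).
rewrite (bigD1 o)//= -fC muleC.
rewrite -ge0_integralZl_EFin//; last 2 first.
  by move=> w _; rewrite lee_fin.
  by apply/measurable_EFinP; exact: measurable_comp_RV.
under [RHS]eq_integral do rewrite -EFinM mulrC.
apply: (@eq_integral_comp_mul (X k) g (fun=> C)) => // B mB.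
pose FB' i : R -> R := if i == k then \1_B else F i.
have FB'k : FB' k = \1_B by rewrite /FB' eqxx.
have mFB i : measurable_fun setT (FB' i).
  by rewrite /FB'; case: ifP => // _; exact: measurable_indic.
have FB0 i x : (0 <= FB' i x)%R by rewrite /FB'; case: ifP.
have E1 : \int[P]_w (\1_B (X k w))%:E <= 1.
  by rewrite expectation_indic_comp// probability_le1//; exact: measurable_preimage_RV.
have FBoo i : \int[P]_w (FB' i (X i w))%:E < +oo.
  rewrite /FB'; case: eqP => [->|_]; last exact: Foo.
  by rewrite (le_lt_trans E1) ?ltry.
have := IH FB' mFB FB0 FBoo; rewrite [X in _ = X](bigD1 o)//= FB'k.
rewrite [X in _ * X](_ : _ = C%:E); last first.
  rewrite fC; apply: eq_bigr => i io; rewrite /FB' ifF//.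
  by apply/negbTE; apply: contra io => /eqP ik; apply/eqP/val_inj.
move=> IH'.
transitivity (\int[P]_w (\prod_(i < N) FB' i (X i w))%:E).
  apply: eq_integral => w _; rewrite (bigD1 o)//= FB'k; congr (_ * _)%:E.
  apply: eq_bigr => i io; rewrite /FB' ifF//.
  by apply/negbTE; apply: contra io => /eqP ik; apply/eqP/val_inj.
rewrite IH'.
  under [RHS]eq_integral do rewrite EFinM.
  rewrite ge0_integralZr//.
  by apply/measurable_EFinP/measurable_comp_RV; exact: measurable_indic.
move=> i; rewrite /FB' leq_eqVlt => /predU1P[<-|ki] iN.
  by exists B; rewrite ?eqxx.
rewrite ifF; first exact: FB.
by apply/negbTE; rewrite gtn_eqF.
Qed.

End product.

(** * Duality of the norms of sequences *)

Section deterministic.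
Context (R : realType).
Local Open Scope ring_scope.

Lemma conjugate_exponents (p : R) (q : \bar R) : 1 <= p ->
  (p%:E^-1 + q^-1 = 1)%E ->
  (p = 1 /\ q = +oo%E) \/
  exists s, [/\ q = s%:E, 1 < p, 1 < s & p^-1 + s^-1 = 1].
Proof.
move=> p1; have p0 : 0 < p by rewrite (lt_le_trans _ p1).
rewrite inver gt_eqF//; case: q => [s| |].
- rewrite inver; case: eqP => [//|/eqP s0] [pq]; right; exists s.
  have ip1 : p^-1 <= 1 by rewrite invf_le1.
  have s_gt0 : 0 < s.
    rewrite lt_neqAle eq_sym s0/= -invr_ge0.
    have -> : s^-1 = 1 - p^-1 by rewrite -pq addrAC subrr add0r.
    by rewrite subr_ge0.
  have sp : s^-1 < 1 by rewrite -pq ltrDr invr_gt0.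
  split => //; last by rewrite -invf_lt1.
  by rewrite -invf_lt1// -pq ltrDl invr_gt0.
- by rewrite invey adde0 => -[/eqP]; rewrite invr_eq1 => /eqP ->; left.
- by rewrite inveNy.
Qed.

Lemma partial_sum_le_nneseries (u : nat -> R) (l : R) : (forall n, 0 <= u n) ->
  (\sum_(0 <= n <oo) (u n)%:E <= l%:E)%E <-> forall m, \sum_(i < m) u i <= l.
Proof.
move=> u0; split=> [ul m|ul].
  rewrite -lee_fin; apply: le_trans ul.
  rewrite -sumEFin -(big_mkord xpredT (fun i => (u i)%:E)).
  by apply: nneseries_lim_ge => n _ _; rewrite lee_fin.
apply: lime_le; first by apply: is_cvg_nneseries => n _ _; rewrite lee_fin.
by apply: nearW => m; rewrite big_mkord sumEFin lee_fin.
Qed.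

Section norms.
Context (a : nat -> R) (A : R).
Context (a_gt0 : forall n, 0 < a n) (aA : forall m, \sum_(i < m) a i <= A).

Let a_ge0 n : 0 <= a n. Proof. exact: ltW. Qed.

Let a_le n : a n <= A.
Proof.
apply: le_trans (aA n.+1); rewrite big_ord_recr/= lerDr.
exact: sumr_ge0.
Qed.

Lemma seq_norm_pinftyP (N := fine (seq_norm +oo%E a)) :
  [/\ 0 < N, forall n, a n <= N & forall y, y < N -> exists n, y < a n].
Proof.
have Nfin : (seq_norm +oo%E a) \is a fin_num.
  rewrite ge0_fin_numE; last first.
    by apply: ereal_sup_ge; exists `|a 0%N|%:E => //; exists 0%N.
  apply: (@le_lt_trans _ _ A%:E); last exact: ltry.
  by apply: ub_ereal_sup => _ [n _ <-]; rewrite lee_fin ger0_norm.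
have aN n : a n <= N.
  rewrite -lee_fin fineK//; apply: ereal_sup_ubound; exists n => //.
  by rewrite ger0_norm.
split=> // [|y]; first exact: lt_le_trans (a_gt0 0) (aN 0%N).
rewrite -lte_fin fineK// => /ereal_sup_gt[_ [n _ <-]].
by rewrite lte_fin ger0_norm//; exists n.
Qed.

(** The norm is finite because a is bounded by A, so that a^s <= A^(s-1) a. *)
Lemma seq_norm_finP (s : R) (N := fine (seq_norm s%:E a)) : 1 < s ->
  [/\ 0 < N, forall m, \sum_(i < m) a i `^ s <= N `^ s &
      forall y, y < N `^ s -> exists m, y < \sum_(i < m) a i `^ s].
Proof.
move=> s1; have s0 : 0 < s by rewrite (lt_trans _ s1).
have as0 n : 0 <= a n `^ s by exact: powR_ge0.
have asA m : \sum_(i < m) a i `^ s <= A `^ (s - 1) * A.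
  apply: (@le_trans _ _ (A `^ (s - 1) * \sum_(i < m) a i)); last first.
    by rewrite ler_wpM2l// powR_ge0.
  rewrite mulr_sumr; apply: ler_sum => i _.
  rewrite -(@mulr_powRB1 _ (a i) s)// mulrC ler_wpM2r//.
  have A0 : 0 <= A by exact: le_trans (a_ge0 i) (a_le i).
  by rewrite ge0_ler_powR ?nnegrE// subr_ge0 ltW.
pose U := (\sum_(0 <= n <oo) (a n `^ s)%:E)%E.
have U0 : (0 <= U)%E by apply: nneseries_ge0 => n _ _; rewrite lee_fin.
have Ufin : U \is a fin_num.
  rewrite ge0_fin_numE//; apply: le_lt_trans (ltry (A `^ (s - 1) * A)).
  exact/(partial_sum_le_nneseries _ as0).
have NU : N `^ s = fine U.
  rewrite /N /seq_norm; under eq_eseriesr do rewrite ger0_norm//.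
  rewrite -/U fine_poweR -powRrM mulVf ?gt_eqF// powRr1//.
  exact: fine_ge0.
have UN m : \sum_(i < m) a i `^ s <= N `^ s.
  by move: m; apply/(partial_sum_le_nneseries _ as0); rewrite NU fineK.
split=> // [|y yN].
  have : 0 < N `^ s.
    by apply: lt_le_trans (UN 1%N); rewrite big_ord1 powR_gt0.
  apply: gt0_powR => //; rewrite /N /seq_norm.
  by rewrite fine_ge0// poweR_ge0.
apply: contrapT => /forallNP yU; move: yN; apply/negP.
rewrite -leNgt NU -lee_fin fineK//.
apply/(partial_sum_le_nneseries _ as0) => m; rewrite leNgt; exact/negP.
Qed.

(** The upper half of the duality, at the level r and with Lagrange multiplier
p r^(p-1) N^(-p).  For p = 1 it is a_n <= N, with b = 0.  For p > 1 the Young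
inequality is applied to x and z_n = r^(p-1) N^(-p) a_n; it leaves
b_n = (p - 1) z_n^q, whose sum is (p - 1) r^p N^(-p) since (p - 1) q = p. *)
Lemma dual_norm_bound (p : R) (q : \bar R) (r : R) (N := fine (seq_norm q a)) :
  1 <= p -> (p%:E^-1 + q^-1 = 1)%E ->
  exists b : nat -> R, [/\ forall n, 0 <= b n,
    forall n (x : R), 0 <= x ->
      p * r `^ (p - 1) * N `^ (- p) * a n * x <= x `^ p + b n &
    forall m, \sum_(i < m) b i <= (p - 1) * r `^ p * N `^ (- p)].
Proof.
move=> p1 pq.
have [[? ?]|[s [? {}p1 s1 {}pq]]] := conjugate_exponents p1 pq.
  subst p q; have [N0 aN _] := seq_norm_pinftyP; rewrite -/N in N0 aN.
  exists (fun=> 0); split=> // [n x x0|m]; last by rewrite big1// subrr !mul0r.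
  rewrite subrr powRr0 !mul1r addr0 powRr1// powR_inv1 ?(ltW N0)//.
  by rewrite ler_piMl// mulrC ler_pdivrMr// mul1r.
subst q; have [N0 NU _] := seq_norm_finP s1; rewrite -/N in N0 NU.
have p0 : 0 < p by rewrite (lt_trans _ p1).
have s0 : 0 < s by rewrite (lt_trans _ s1).
have ps : p / s = p - 1.
  have -> : s^-1 = 1 - p^-1 by rewrite -pq addrAC subrr add0r.
  by rewrite mulrBr mulr1 divff// gt_eqF.
have ps' : (p - 1) * s = p by rewrite -ps divfK// gt_eqF.
pose z n := r `^ (p - 1) * N `^ (- p) * a n.
have z0 n : 0 <= z n by rewrite !mulr_ge0 ?powR_ge0.
exists (fun n => (p - 1) * z n `^ s); split=> [n|n x x0|m].
- by rewrite mulr_ge0 ?powR_ge0// subr_ge0 ltW.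
- have := conjugate_powR x0 (z0 n) p0 s0 pq.
  rewrite -(ler_pM2l p0).
  have -> : p * (x `^ p / p + z n `^ s / s) = x `^ p + p / s * z n `^ s.
    by field; rewrite !gt_eqF.
  by rewrite ps; apply: le_trans; rewrite le_eqVlt; apply/orP; left;
     apply/eqP; rewrite /z; ring.
- rewrite -mulr_sumr -mulrA ler_wpM2l ?subr_ge0 ?(ltW p1)//.
  under eq_bigr do rewrite /z powRM ?mulr_ge0 ?powR_ge0//.
  rewrite -mulr_sumr.
  rewrite powRM ?powR_ge0// -!powRrM ps' -mulrA ler_wpM2l ?powR_ge0//.
  have {2}-> : - p = - p * s + s by rewrite -{1}ps'; ring.
  rewrite powRD; last by apply/implyP => _; rewrite gt_eqF.
  by rewrite ler_wpM2l ?powR_ge0.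
Qed.

(** The lower half of the duality: N^(-p) is approached by finitely supported x.  For
p = 1 all the mass is put on one nearly maximal a_n; for p > 1 the Hoelder
equality case x_i = a_i^(q-1) / U is used, where U = sum_(i < m) a_i^q, which gives
sum_(i < m) x_i^p = U^(1-p). *)
Lemma primal_norm_witness (p : R) (q : \bar R) (t : R) (N := fine (seq_norm q a)) :
  1 <= p -> (p%:E^-1 + q^-1 = 1)%E -> N `^ (- p) < t ->
  exists m, exists x : nat -> R, [/\ forall i, 0 <= x i,
    1 <= \sum_(i < m) a i * x i & \sum_(i < m) x i `^ p <= t].
Proof.
move=> p1 pq Nt; have t0 : 0 < t by rewrite (le_lt_trans _ Nt)// powR_ge0.
have [[? ?]|[s [? {}p1 s1 {}pq]]] := conjugate_exponents p1 pq.
  subst p q; have [N0 _ aN] := seq_norm_pinftyP; rewrite -/N in N0 aN.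
  have [n tn] : exists n, t^-1 < a n.
    apply: aN; move: Nt; rewrite powR_inv1 ?(ltW N0)//.
    by rewrite -[in X in X -> _](invrK t) ltf_pV2 ?posrE ?invr_gt0.
  exists n.+1, (fun i => if i == n then (a n)^-1 else 0); split=> [i||].
  - by case: ifP => // _; rewrite invr_ge0.
  - rewrite big_ord_recr/= eqxx divff ?gt_eqF// lerDr.
    by apply: sumr_ge0 => i _; case: ifP => _; rewrite ?mulr0// mulr_ge0 ?invr_ge0.
  - rewrite big_ord_recr/= eqxx big1 ?add0r => [|i _].
      rewrite powRr1 ?invr_ge0// -[leRHS]invrK lef_pV2 ?posrE ?invr_gt0//.
      exact: ltW.
    by rewrite ltn_eqF// powR0// oner_neq0.
subst q; have [N0 _ NU] := seq_norm_finP s1; rewrite -/N in N0 NU.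
have p0 : 0 < p by rewrite (lt_trans _ p1).
have s0 : 0 < s by rewrite (lt_trans _ s1).
have pB1 : 0 < p - 1 by rewrite subr_gt0.
have ps : p / s = p - 1.
  have -> : s^-1 = 1 - p^-1 by rewrite -pq addrAC subrr add0r.
  by rewrite mulrBr mulr1 divff// gt_eqF.
have ps' : (p - 1) * s = p by rewrite -ps divfK// gt_eqF.
pose y := t `^ (- (p - 1)^-1).
have y0 : 0 < y by rewrite powR_gt0.
have yN : y < N `^ s.
  have -> : N `^ s = (N `^ (- p)) `^ (- (p - 1)^-1).
    have sE : s = p / (p - 1) by rewrite -{1}ps' mulrAC divff ?mul1r// gt_eqF.
    by rewrite -powRrM mulrNN {1}sE.
  rewrite /y !powRN ltf_pV2 ?posrE ?powR_gt0// ?invr_gt0 ?powR_gt0//.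
  by rewrite -powRN gt0_ltr_powR ?invr_gt0// ?nnegrE ?powR_ge0// ltW.
have [m ym] := NU _ yN.
pose U := \sum_(i < m) a i `^ s; rewrite -/U in ym.
have U0 : 0 < U by exact: lt_trans ym.
exists m, (fun i => a i `^ (s - 1) / U); split=> [i||].
- by rewrite divr_ge0 ?powR_ge0// ltW.
- under eq_bigr do rewrite mulrA mulr_powRB1//.
  by rewrite -mulr_suml divff ?gt_eqF.
- have E i : (a i `^ (s - 1) / U) `^ p = a i `^ s * U `^ (- p).
    rewrite powRM ?powR_ge0 ?invr_ge0 ?(ltW U0)// -powRrM.
    have -> : (s - 1) * p = s by rewrite mulrBl mul1r -{2}ps'; ring.
    by rewrite -powR_inv1 ?(ltW U0)// -powRrM mulN1r.
  under eq_bigr do rewrite E.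
  rewrite -mulr_suml -/U.
  have -> : t = y `^ (- (p - 1)).
    by rewrite /y -powRrM mulrNN mulVf ?gt_eqF// powRr1// ltW.
  rewrite -{1}[U]powRr1 ?(ltW U0)// -powRD; last first.
    by apply/implyP => _; rewrite gt_eqF.
  rewrite -[1 - p]opprB !powRN lef_pV2 ?posrE ?powR_gt0//.
  by rewrite ge0_ler_powR ?nnegrE// ltW.
Qed.

End norms.
End deterministic.

(** * Tails and exponential moments *)

Section tail.
Context (R : realType).
Local Open Scope ring_scope.

(** The limit only constrains f u for large u.  Monotonicity and 0 <= f <= 1 extend
the two bounds to all u >= 0 at the price of a constant factor exp L, which makes
them usable for products of many tails at once. *)
Lemma tail_exponential_bounds (f : R -> R) (p c : R) : 0 < p ->
  (forall u, 0 <= f u <= 1) -> (forall u v, u <= v -> f v <= f u) ->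
  (fun u : R => ((u `^ (- p))%:E * lne (f u)%:E)%E) @ +oo --> (- c)%:E ->
  (forall c1, 0 < c1 < c ->
    exists L, forall u, 0 <= u -> f u <= expR (L - c1 * u `^ p)) /\
  (forall c2, c < c2 -> 0 < c2 ->
    exists L, forall u, 0 <= u -> expR (- (c2 * u `^ p) - L) <= f u).
Proof.
move=> p0 f01 fdec fc; split=> [c1 /andP[c10 c1c]|c2 cc2 c20].
  have cc1 : ((- c)%:E < (- c1)%:E)%E by rewrite lte_fin ltrN2.
  have [M [_ HM0]] := fc _ (open_ereal_lt' cc1).
  have HM u : M < u ->
    ((u `^ (- p))%:E * lne (f u)%:E < (- c1)%:E)%E := HM0 u.
  pose M' := Num.max (M + 1) 1.
  have M'1 : 1 <= M' by rewrite /M' le_max lexx orbT.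
  exists (c1 * M' `^ p) => u u0.
  have [uM|Mu] := leP u M'.
    have /andP[_ /le_trans->]// := f01 u.
    rewrite -expR0 ler_expR subr_ge0 ler_pM2l//.
    by rewrite ge0_ler_powR ?nnegrE ?(ltW p0)// (le_trans u0).
  have u_gt0 : 0 < u by rewrite (lt_trans _ Mu)// (lt_le_trans _ M'1).
  have up : 0 < u `^ p by rewrite powR_gt0.
  have /HM : M < u.
    by apply: le_lt_trans Mu; rewrite /M' le_max lerDl ler01.
  have [fu0|fu0] := leP (f u) 0; first by rewrite (le_trans fu0)// expR_ge0.
  rewrite lne_EFin// -EFinM lte_fin powRN mulrC ltr_pdivrMr// => H.
  rewrite -[f u]lnK ?posrE// ler_expR.
  apply: (@le_trans _ _ (- (c1 * u `^ p))); first by rewrite -mulNr ltW.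
  by rewrite lerDr mulr_ge0 ?powR_ge0 ?ltW.
have cc1 : ((- c2)%:E < (- c)%:E)%E by rewrite lte_fin ltrN2.
have [M [_ HM0]] := fc _ (open_ereal_gt' cc1).
have HM u : M < u ->
  ((- c2)%:E < (u `^ (- p))%:E * lne (f u)%:E)%E := HM0 u.
pose M' := Num.max (M + 1) 1.
have M'1 : 1 <= M' by rewrite /M' le_max lexx orbT.
have main u : M' <= u -> expR (- (c2 * u `^ p)) <= f u.
  move=> Mu.
  have u_gt0 : 0 < u by rewrite (lt_le_trans _ Mu)// (lt_le_trans _ M'1).
  have up : 0 < u `^ p by rewrite powR_gt0.
  have /HM : M < u.
    by apply: lt_le_trans Mu; rewrite /M' lt_max ltrDl ltr01.
  have [fu0|fu0] := leP (f u) 0.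
    by rewrite le0_lneNy ?lee_fin// gt0_muleNy ?lte_fin ?powR_gt0.
  rewrite lne_EFin// -EFinM lte_fin powRN mulrC ltr_pdivlMr// => H.
  by rewrite -[f u]lnK ?posrE// ler_expR -mulNr ltW.
exists (c2 * M' `^ p) => u u0.
have [uM|Mu] := leP u M'.
  apply: le_trans (fdec _ _ uM); apply: le_trans (main _ (lexx _)).
  by rewrite ler_expR gerDr oppr_le0 mulr_ge0 ?powR_ge0 ?ltW.
apply: le_trans (main _ (ltW Mu)).
by rewrite ler_expR gerDl oppr_le0 mulr_ge0 ?powR_ge0 ?ltW.
Qed.

End tail.

Section moments.
Context (R : realType) (d : measure_display) (T : measurableType d)
  (P : probability T R).

Lemma lee_prode (N : nat) (F G : nat -> \bar R) :
  (forall i, 0 <= F i) -> (forall i, F i <= G i) ->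
  \prod_(i < N) F i <= \prod_(i < N) G i.
Proof.
move=> F0 FG.
suff: 0 <= \prod_(i < N) F i /\ \prod_(i < N) F i <= \prod_(i < N) G i by case.
elim/big_ind2 : _ => [|x1 x2 y1 y2 [? ?] [? ?]|i _]; [split=> //| |by []].
by split; [exact: mule_ge0|exact: lee_pmul].
Qed.

Lemma expectation_identically_distributed (X : nat -> {RV P >-> R})
    (f : R -> R) n :
  identically_distributed X ->
  measurable_fun setT f -> (forall x, (0 <= f x)%R) ->
  \int[P]_w (f (X n w))%:E = \int[P]_w (f (X 0%N w))%:E.
Proof.
move=> hid mf f0.
have mfE : measurable_fun [set: R] (EFin \o f) by exact/measurable_EFinP.
have f0E y : 0 <= (EFin \o f) y by rewrite lee_fin.
have := ge0_integral_distribution (X n) mfE f0E.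
have := ge0_integral_distribution (X 0%N) mfE f0E.
move=> /= <- <-; apply: eq_measure_integral => B mB _.
exact: hid.
Qed.

(** Cut the values of V into unit intervals: exp (c2 V) is at most
exp (c2 (k + 1)) when k <= V < k + 1, and the tail makes the resulting series
geometric of ratio exp (c2 - c1). *)
Lemma exp_moment_lty (V : T -> R) (c1 c2 K : R) :
  measurable_fun setT V -> (forall w, (0 <= V w)%R) -> (0 <= c2 < c1)%R ->
  (forall u : R, (0 <= u)%R -> P [set w | (u <= V w)%R] <= (expR (K - c1 * u))%:E) ->
  \int[P]_w (expR (c2 * V w))%:E < +oo.
Proof.
move=> mV V0 /andP[c20 c21] tail.
pose B (k : nat) := [set w | (k%:R <= V w)%R].
have mB k : measurable (B k).
  have := emeasurable_fun_c_infty measurableT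
    (proj2 (measurable_EFinP _ _) mV) k%:R%:E.
  by rewrite setTI.
pose g (k : nat) w : \bar R := (expR (c2 * k.+1%:R) * \1_(B k) w)%:E.
have g0 k w : 0 <= g k w by rewrite lee_fin mulr_ge0 ?expR_ge0.
have mg k : measurable_fun setT (g k).
  by apply/measurable_EFinP; exact: measurable_funM.
have Vg w : (expR (c2 * V w))%:E <= \sum_(0 <= k <oo) g k w.
  have /andP[kV Vk] := truncn_itv (V0 w).
  move: kV Vk; set k := Num.trunc _ => kV Vk.
  apply: (@le_trans _ _ (\sum_(0 <= i < k.+1) g i w)); last first.
    exact: nneseries_lim_ge.
  rewrite big_nat_recr//=; apply: (@le_trans _ _ (g k w)); last first.
    by rewrite leeDr// sume_ge0.
  rewrite /g indicE mem_set// mulr1 lee_fin ler_expR.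
  by rewrite ler_wpM2l// ltW.
apply: (@le_lt_trans _ _ (\int[P]_w \sum_(0 <= k <oo) g k w)).
  apply: ge0_le_integral => //.
  - apply/measurable_EFinP; apply: measurableT_comp => //.
    exact: measurable_funM.
  - by apply: ge0_emeasurable_sum => // k w _ _.
rewrite integral_nneseries//.
pose h : R := expR (c2 - c1).
pose C : R := expR (c2 + K).
have h1 : (0 < 1 - h)%R by rewrite subr_gt0 expR_lt1 subr_lt0.
apply: (@le_lt_trans _ _ (\sum_(0 <= k <oo) (C * h ^+ k)%:E)).
  apply: lee_nneseries => [k _ _|k _]; first by apply: integral_ge0 => w _; exact: g0.
  rewrite /g; under eq_integral do rewrite EFinM.
  rewrite ge0_integralZl_EFin ?expR_ge0//; last first.
    by apply/measurable_EFinP; exact: measurable_indic.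
  rewrite integral_indic// setIT.
  apply: (@le_trans _ _ ((expR (c2 * k.+1%:R))%:E * (expR (K - c1 * k%:R))%:E)).
    by rewrite lee_wpmul2l ?lee_fin ?expR_ge0// tail.
  rewrite -EFinM lee_fin /C /h -expRM_natl -!expRD ler_expR.
  by rewrite le_eqVlt; apply/orP; left; apply/eqP; rewrite -natr1; ring.
apply: (@le_lt_trans _ _ (C / (1 - h))%:E); last exact: ltry.
apply/partial_sum_le_nneseries => [k|m].
  by rewrite mulr_ge0 ?exprn_ge0// expR_ge0.
rewrite -mulr_sumr ler_wpM2l ?expR_ge0//.
rewrite -[leRHS]mul1r ler_pdivlMr// mulrC.
have -> : ((1 - h) * \sum_(i < m) h ^+ i = 1 - h ^+ m)%R.
  by rewrite -opprB mulNr -subrX1 opprB.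
by rewrite gerBl exprn_ge0// expR_ge0.
Qed.

Lemma expR_chord_le (s y : R) : (0 <= s <= 1)%R ->
  (expR (s * y) <= 1 + s * expR y)%R.
Proof.
move=> /andP[s0 s1].
have := @convex_expR R (Itv01 s0 s1) y (0 : R)%R.
rewrite !convRE /= expR0 mulr0 addr0 mulr1 => /le_trans; apply.
by rewrite addrC lerD2r gerBl.
Qed.

(** The constant M = E exp (k X^p) must not appear as a factor when the variable is
multiplied by a small t, because such factors pile up along the series; here
it only enters through the exponent, linearly in t.  For t <= k, convexity
of exp on [0, k X] gives 1 + O(t), using X <= 1 + X^p; for t > k, the factor M is
absorbed by exp (M t / k). *)
Lemma mgf_le_of_young (X : T -> R) (p k M t b : R) :
  measurable_fun setT X -> (forall w, (0 <= X w)%R) -> (1 <= p)%R ->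
  (0 < k)%R -> \int[P]_w (expR (k * X w `^ p))%:E = M%:E ->
  (0 <= t)%R -> (0 <= b)%R ->
  (forall x, 0 <= x -> t * x <= k * x `^ p + b)%R ->
  \int[P]_w (expR (t * X w))%:E <= (expR (b + M * expR k / k * t))%:E.
Proof.
move=> mX X0 p1 k0 EM t0 b0 young.
have mexp (f : T -> R) : measurable_fun setT f ->
    measurable_fun setT (fun w => (expR (f w))%:E).
  by move=> mf; apply/measurable_EFinP; exact: measurableT_comp.
have mXp : measurable_fun setT (fun w => k * X w `^ p)%R.
  apply: measurable_funM => //.
  exact: (measurableT_comp (@measurable_powR R p) mX).
have mtX : measurable_fun setT (fun w => t * X w)%R by exact: measurable_funM.
have M0 : (0 <= M)%R.
  by rewrite -lee_fin -EM integral_ge0// => w _; rewrite lee_fin expR_ge0.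
have e0 (f : T -> R) w : 0 <= (expR (f w))%:E by rewrite lee_fin expR_ge0.
have [tk|kt] := leP t k.
  pose s := (t / k)%R.
  have s01 : (0 <= s <= 1)%R by rewrite divr_ge0 ?(ltW k0)//= ler_pdivrMr ?mul1r.
  have s0 : (0 <= s)%R by case/andP: s01.
  apply: (@le_trans _ _ (\int[P]_w (1 + (s * expR k)%:E * (expR (k * X w `^ p))%:E))).
    apply: ge0_le_integral => //.
    - exact: mexp.
    - by apply: emeasurable_funD => //; apply: measurable_funeM; exact: mexp.
    - move=> w _; rewrite -EFinM -EFinD lee_fin.
      have -> : (t * X w = s * (k * X w))%R by rewrite mulrA divfK// gt_eqF.
      apply: le_trans (expR_chord_le _ s01) _.
      rewrite lerD2l -[leRHS]mulrA ler_wpM2l// -expRD ler_expR -{2}[k]mulr1 -mulrDr.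
      rewrite ler_wpM2l ?(ltW k0)//.
      have [X1|X1] := leP 1%R (X w).
        by rewrite (le_trans (le1r_powR X1 p1))// lerDr.
      by rewrite (le_trans (ltW X1))// lerDl powR_ge0.
  have sk0 : (0 <= s * expR k)%R by rewrite (mulr_ge0 s0) ?expR_ge0.
  rewrite ge0_integralD//; last 2 first.
    by move=> w _; rewrite -EFinM lee_fin mulr_ge0 ?expR_ge0// (mulr_ge0 s0) ?expR_ge0.
    by apply: measurable_funeM; exact: mexp.
  rewrite integral_cst//= probability_setT mule1.
  rewrite (ge0_integralZl_EFin _ _ _ _ sk0)//; last first.
    exact: mexp.
  rewrite EM -EFinM -EFinD lee_fin.
  apply: le_trans (expR_ge1Dx _) _; rewrite ler_expR.
  by rewrite ler_wpDl// le_eqVlt; apply/orP; left; apply/eqP; rewrite /s; ring.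
apply: (@le_trans _ _ (\int[P]_w ((expR b)%:E * (expR (k * X w `^ p))%:E))).
  apply: ge0_le_integral => //.
  - exact: mexp.
  - by apply: measurable_funeM; exact: mexp.
  - move=> w _; rewrite -EFinM lee_fin -expRD ler_expR addrC.
    exact: young.
rewrite ge0_integralZl_EFin ?expR_ge0//; last exact: mexp.
rewrite EM -EFinM lee_fin expRD ler_wpM2l ?expR_ge0//.
apply: (@le_trans _ _ (expR M)).
  by rewrite (le_trans _ (expR_ge1Dx _))// lerDr.
rewrite ler_expR -!mulrA ler_peMr//.
have tk1 : (1 <= k^-1 * t)%R by rewrite mulrC ler_pdivlMr ?mul1r// ltW.
by rewrite (le_trans tk1)// ler_peMl ?(le_trans ler01)// -expR0 ler_expR ltW.
Qed.

(** If the series is at least r, then for every e > 0 some partial sum is at least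
r - e, and these events increase; the Markov inequality bounds each of them. *)
Lemma chernoff_nneseries (Y : nat -> T -> R) (l B r : R) :
  (forall n, measurable_fun setT (Y n)) -> (forall n w, (0 <= Y n w)%R) ->
  (0 <= l)%R ->
  (forall m, \int[P]_w (expR (l * \sum_(i < m) Y i w))%:E <= (expR B)%:E) ->
  P [set w | r%:E <= \sum_(0 <= n <oo) (Y n w)%:E] <= (expR (B - l * r))%:E.
Proof.
move=> mY Y0 l0 EB.
pose S m w := (\sum_(i < m) Y i w)%R.
have mS m : measurable_fun setT (S m) by exact: measurable_sum.
have mSoo : measurable [set w | r%:E <= \sum_(0 <= n <oo) (Y n w)%:E].
  rewrite -[X in measurable X]setTI; apply: emeasurable_fun_c_infty => //.
  apply: ge0_emeasurable_sum => [k w _ _|k _]; first by rewrite lee_fin.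
  exact/measurable_EFinP.
have mlev m t : measurable [set w | (t <= S m w)%R].
  have := emeasurable_fun_c_infty measurableT
    (proj2 (measurable_EFinP _ _) (mS m)) t%:E.
  by rewrite setTI.
have markovS m t : P [set w | (t <= S m w)%R] <= (expR (B - l * t))%:E.
  rewrite -[X in P X]setIT -integral_indic//.
  apply: (@le_trans _ _ (\int[P]_w ((expR (- (l * t)))%:E * (expR (l * S m w))%:E))).
    apply: ge0_le_integral => //.
    - by apply/measurable_EFinP; exact: measurable_indic.
    - apply: measurable_funeM; apply/measurable_EFinP.
      by apply: measurableT_comp => //; exact: measurable_funM.
    - move=> w _; rewrite -EFinM lee_fin -expRD indicE.
      case: (boolP (w \in _)) => [/set_mem /= tS|_]; last exact: expR_ge0.
      by rewrite -expR0 ler_expR addrC subr_ge0 ler_wpM2l.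
  rewrite ge0_integralZl_EFin ?expR_ge0//; last first.
    by apply/measurable_EFinP; apply: measurableT_comp => //; exact: measurable_funM.
  by rewrite addrC expRD EFinM lee_wpmul2l ?EB// lee_fin expR_ge0.
have step e : (0 < e)%R -> P [set w | r%:E <= \sum_(0 <= n <oo) (Y n w)%:E]
    <= (expR (B - l * (r - e)))%:E.
  move=> e0; pose F m := [set w | (r - e <= S m w)%R].
  have sub : [set w | r%:E <= \sum_(0 <= n <oo) (Y n w)%:E] `<=` \bigcup_m F m.
    move=> w /= rS; apply: contrapT => nF.
    have : \sum_(0 <= n <oo) (Y n w)%:E <= (r - e)%:E.
      apply/(partial_sum_le_nneseries _ (Y0 ^~ w)) => m; rewrite leNgt; apply/negP => Sm.
      by apply: nF; exists m => //; exact: ltW.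
    by move/(le_trans rS); rewrite lee_fin lerBrDr gerDl leNgt e0.
  have mF : measurable (\bigcup_m F m) by apply: bigcup_measurable => m _; exact: mlev.
  apply: (@le_trans _ _ (P (\bigcup_m F m))).
    by apply: le_measure => //; rewrite inE.
  have cv : (P \o F) x @[x --> \oo] --> P (\bigcup_m F m).
    apply: nondecreasing_cvg_mu => [m|//|m n mn]; first exact: mlev.
    apply/subsetPset => w /= /le_trans; apply.
    rewrite /S -!(big_mkord xpredT (fun i => Y i w)).
    by rewrite [leRHS](big_cat_nat (n := m))//= lerDl sumr_ge0.
  rewrite -(cvg_lim _ cv)//; apply: lime_le; first by apply/cvg_ex; exists (P (\bigcup_m F m)).
  by apply: nearW => m; exact: markovS.
set p := P _ in step *.
have pfin : p \is a fin_num by exact: fin_num_measure.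
rewrite -(fineK pfin) lee_fin.
have [p0|p0] := leP (fine p) 0%R; first by rewrite (le_trans p0)// expR_ge0.
rewrite -[fine p]lnK ?posrE// ler_expR.
have stepR e : (0 < e)%R -> (ln (fine p) <= B - l * (r - e))%R.
  by move=> /step; rewrite -{1}(fineK pfin) lee_fin -{1}[fine p]lnK ?posrE// ler_expR.
apply/ler_addgt0Pr => e e0.
have l1 : (0 < l + 1)%R by rewrite ltr_wpDl.
apply: le_trans (stepR (e / (l + 1))%R (divr_gt0 e0 l1)) _.
have -> : (B - l * (r - e / (l + 1)) = B - l * r + e * (l / (l + 1)))%R by ring.
rewrite lerD2l ler_piMr ?(ltW e0)//.
by rewrite ler_pdivrMr// mul1r lerDl.
Qed.

End moments.

(** * Weighted sums of independent variables *)

Section weighted_sums.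
Context (R : realType) (d : measure_display) (T : measurableType d)
  (P : probability T R) (xi : nat -> {RV P >-> R}).
Context (hindep : mutually_independent xi) (hid : identically_distributed xi).
Context (a : nat -> R) (a_gt0 : forall n, (0 < a n)%R).

Let a_ge0 n : (0 <= a n)%R. Proof. exact: ltW. Qed.

Let S w : \bar R := \sum_(0 <= n <oo) (a n * `|xi n w|)%:E.

Let mabs n : measurable_fun setT (fun w => `|xi n w|)%R.
Proof. by apply: measurableT_comp => //; exact: normr_measurable. Qed.

Let mge (u : R) : measurable [set x : R | (u <= `|x|)%R].
Proof.
have mn : measurable_fun [set: R] (EFin \o Num.Def.normr).
  by apply/measurable_EFinP; exact: normr_measurable.
by have := emeasurable_fun_c_infty measurableT mn u%:E; rewrite setTI.
Qed.

Lemma measurable_tail n (u : R) : measurable [set w | (u <= `|xi n w|)%R].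
Proof. exact: (measurable_preimage_RV (xi n) (mge u)). Qed.

Let mS : measurable_fun setT S.
Proof.
apply: ge0_emeasurable_sum => [k w _ _|k _]; first by rewrite lee_fin mulr_ge0.
by apply/measurable_EFinP; exact: measurable_funM.
Qed.

Lemma measurable_series_tail (r : R) : measurable [set w | r%:E <= S w].
Proof. by rewrite -[X in measurable X]setTI; exact: emeasurable_fun_c_infty. Qed.

Lemma tail_identically_distributed n (u : R) :
  P [set w | (u <= `|xi n w|)%R] = P [set w | (u <= `|xi 0%N w|)%R].
Proof. exact: (hid n (mge u)). Qed.

(** exp (- s X) + (1 - exp (- s)) 1_(X >= 1) <= 1; integrate. *)
Lemma laplace_le (s h : R) : (0 <= s)%R ->
  (h <= fine (P [set w | (1 <= `|xi 0%N w|)%R]))%R ->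
  \int[P]_w (expR (- (s * `|xi 0%N w|)))%:E <=
    (expR (- (h * (1 - expR (- s)))))%:E.
Proof.
move=> s0 hP; set D := [set w | _] in hP.
have mD : measurable D by exact: measurable_tail.
have Dfin : P D \is a fin_num by exact: fin_num_measure.
have k0 : (0 <= 1 - expR (- s))%R by rewrite subr_ge0 expR_le1 oppr_le0.
have mE : measurable_fun setT (fun w => (expR (- (s * `|xi 0%N w|)))%:E).
  apply/measurable_EFinP; apply: measurableT_comp => //.
  by apply: measurable_funN; exact: measurable_funM.
have le1 : \int[P]_w ((expR (- (s * `|xi 0%N w|)))%:E
     + (1 - expR (- s))%:E * (\1_D w)%:E) <= 1.
  rewrite -(probability_setT P) -[leRHS]mul1e -integral_cst//.
  apply: ge0_le_integral => //.
  - by move=> w _; rewrite -EFinM -EFinD lee_fin addr_ge0 ?expR_ge0// mulr_ge0.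
  - apply: emeasurable_funD => //; apply: measurable_funeM.
    by apply/measurable_EFinP; exact: measurable_indic.
  - move=> w _; rewrite -EFinM -EFinD lee_fin indicE.
    case: (boolP (w \in D)) => [/set_mem /= D1|_]; last first.
      by rewrite mulr0 addr0 expR_le1 oppr_le0 mulr_ge0.
    by rewrite mulr1 addrCA gerDl subr_le0 ler_expR lerN2 ler_peMr.
rewrite ge0_integralD// in le1; last 2 first.
  by move=> w _; rewrite -EFinM lee_fin mulr_ge0.
  apply: measurable_funeM; apply/measurable_EFinP; exact: measurable_indic.
rewrite ge0_integralZl_EFin// in le1; last first.
  by apply/measurable_EFinP; exact: measurable_indic.
have ED : \int[P]_w (\1_D w)%:E = (fine (P D))%:E.
  by rewrite integral_indic// setIT fineK.
rewrite ED -EFinM -leeBrDr// in le1.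
apply: le_trans le1 _; rewrite -EFinB lee_fin.
apply: le_trans (expR_ge1Dx _); rewrite lerD2l lerN2 mulrC.
by rewrite ler_wpM2l.
Qed.

(** As S is almost surely finite, P (S <= M) > 0 for some M.  The expectation of
exp (- sum_(i < m) a_i X_i) is at least exp (- M) P (S <= M), whatever m, and by
independence at most exp (- k sum_(i < m) a_i), which bounds the partial sums of a. *)
Lemma summable_weights (A : R) : (forall n, a n <= A)%R ->
  0 < P [set w | (1 <= `|xi 0%N w|)%R] ->
  {ae P, forall w, S w < +oo} ->
  exists A1, forall m, (\sum_(i < m) a i <= A1)%R.
Proof.
move=> aA hpos hconv.
have A0 : (0 <= A)%R by exact: le_trans (a_ge0 0%N) (aA 0%N).
pose D (M : nat) := [set w | S w <= M%:R%:E].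
have mD M : measurable (D M).
  by rewrite -[X in measurable X]setTI; exact: emeasurable_fun_infty_c.
have [M PM] : exists M, P (D M) != 0.
  apply: contrapT => /forallNP PD0.
  have neg : P.-negligible (\bigcup_M D M).
    apply: negligible_bigcup => M; apply/negligibleP => //.
    by have /negP := PD0 M; rewrite negbK => /eqP.
  have neg2 : P.-negligible [set: T].
    apply: (@negligibleS _ _ _ _ ((\bigcup_M D M) `|` ~` [set w | S w < +oo])).
      move=> w _; have [Sw|Sw] := pselect (S w < +oo); [left|by right].
      have S0 : 0 <= S w by apply: nneseries_ge0 => n _ _; rewrite lee_fin mulr_ge0.
      have Sfin : S w \is a fin_num by rewrite ge0_fin_numE.
      exists (Num.trunc (fine (S w))).+1 => //=.
      rewrite /D/= -(fineK Sfin) lee_fin ltW//.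
      by have /andP[] := truncn_itv (fine_ge0 S0).
    by apply: negligibleU.
  have /eqP : (1 : \bar R) = 0.
    rewrite -(probability_setT P); exact: (proj1 (negligibleP _ measurableT)).
  by rewrite onee_eq0.
set h0 := P [set w | _] in hpos.
have h0fin : h0 \is a fin_num by apply: fin_num_measure; exact: measurable_tail.
pose h := fine h0.
have h_gt0 : (0 < h)%R by rewrite -lte_fin fineK.
have PMfin : P (D M) \is a fin_num by exact: fin_num_measure.
pose y := fine (P (D M)).
have y_gt0 : (0 < y)%R.
  by rewrite -lte_fin fineK// lt_neqAle eq_sym PM measure_ge0.
(* From 1 - exp (- s) >= s / (1 + s) and s = a_i <= A. *)
pose k := (h / (1 + A))%R.
have A1_gt0 : (0 < 1 + A)%R by rewrite ltr_pwDl.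
have k_gt0 : (0 < k)%R by rewrite divr_gt0.
exists ((M%:R - ln y) / k)%R => m.
pose F (i : nat) (x : R) := expR (- (a i * `|x|)).
have mF i : measurable_fun setT (F i).
  apply: measurableT_comp => //; apply: measurable_funN.
  by apply: measurable_funM => //; exact: normr_measurable.
have F0 i x : (0 <= F i x)%R by exact: expR_ge0.
have FE i : \int[P]_w (F i (xi i w))%:E <= (expR (- (k * a i)))%:E.
  rewrite expectation_identically_distributed//.
  apply: le_trans (laplace_le (a_ge0 i) (lexx h)) _.
  rewrite lee_fin ler_expR lerN2 /k -mulrA ler_wpM2l ?(ltW h_gt0)//.
  have ai1 : (0 < 1 + a i)%R by rewrite ltr_pwDl.
  apply: (@le_trans _ _ (1 - (1 + a i)^-1)%R); last first.
    by rewrite lerD2l lerN2 expRN lef_pV2 ?posrE ?expR_gt0// expR_ge1Dx.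
  have -> : (1 - (1 + a i)^-1 = (1 + a i)^-1 * a i)%R.
    by field; rewrite gt_eqF.
  rewrite ler_wpM2r// lef_pV2 ?posrE// lerD2l; exact: aA.
have Foo i : \int[P]_w (F i (xi i w))%:E < +oo by rewrite (le_lt_trans (FE i)) ?ltry.
have FE0 i : 0 <= \int[P]_w (F i (xi i w))%:E.
  by apply: integral_ge0 => w _; rewrite lee_fin.
have up : \int[P]_w (\prod_(i < m) F i (xi i w))%:E <=
    (expR (- (k * \sum_(i < m) a i)))%:E.
  rewrite expectation_prod_independent//.
  apply: le_trans (lee_prode m FE0 FE) _.
  by rewrite prodEFin lee_fin -expR_sum sumrN mulr_sumr.
have low : (expR (- M%:R) * y)%:E <= \int[P]_w (\prod_(i < m) F i (xi i w))%:E.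
  have -> : (expR (- M%:R) * y)%:E =
      (expR (- M%:R))%:E * \int[P]_w (\1_(D M) w)%:E.
    by rewrite integral_indic// setIT EFinM fineK.
  rewrite -ge0_integralZl_EFin ?expR_ge0//; last first.
    by apply/measurable_EFinP; exact: measurable_indic.
  apply: ge0_le_integral => //.
  - by apply: measurable_funeM; apply/measurable_EFinP; exact: measurable_indic.
  - apply/measurable_EFinP; apply: measurable_prod => i _.
    exact: measurable_comp_RV.
  - move=> w _; rewrite -EFinM lee_fin indicE.
    case: (boolP (w \in D M)) => [/set_mem /= DM|_]; last first.
      by rewrite mulr0 prodr_ge0.
    rewrite mulr1 /F -expR_sum ler_expR sumrN lerN2.
    have aX0 n : (0 <= a n * `|xi n w|)%R by rewrite mulr_ge0.
    exact: (proj1 (partial_sum_le_nneseries _ aX0) DM).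
have := le_trans low up; rewrite lee_fin -{1}[y]lnK ?posrE// -expRD ler_expR.
by rewrite lerNr ler_pdivlMr// opprD opprK mulrC.
Qed.

(** The exponential moments of the l a_n X_n multiply to at most exp (B + K l), the
sum of a being absorbed in K.  The certificates b are left arbitrary, since choosing
them well is a question about norms of sequences only. *)
Lemma upper_tail_bound (p k c1 L A : R) : (1 <= p)%R -> (0 < k < c1)%R ->
  (forall u, 0 <= u ->
    fine (P [set w | (u <= `|xi 0%N w|)%R]) <= expR (L - c1 * u `^ p))%R ->
  (forall m, \sum_(i < m) a i <= A)%R ->
  exists K : R, forall (l r B : R) (b : nat -> R),
    (0 <= l)%R -> (forall n, 0 <= b n)%R ->
    (forall n x, 0 <= x -> l * a n * x <= k * x `^ p + b n)%R ->
    (forall m, \sum_(i < m) b i <= B)%R ->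
    P [set w | r%:E <= S w] <= (expR (B + K * l - l * r))%:E.
Proof.
move=> p1 /andP[k0 kc1] tail aA.
have p0 : (0 < p)%R by rewrite (lt_le_trans _ p1).
have mXp : measurable_fun setT (fun w => `|xi 0%N w| `^ p)%R.
  exact: (measurableT_comp (@measurable_powR R p) (mabs 0%N)).
have Moo : \int[P]_w (expR (k * `|xi 0%N w| `^ p))%:E < +oo.
  apply: (@exp_moment_lty _ _ _ P (fun w => `|xi 0%N w| `^ p)%R c1 k L) => //.
  - by rewrite (ltW k0) kc1.
  move=> u u0; have v0 : (0 <= u `^ p^-1)%R by exact: powR_ge0.
  (* [exp_moment_lty] is used for V = X^p, whose tail at u is that of X at u^(1/p). *)
  have vu : (u `^ p^-1 `^ p = u)%R by rewrite -powRrM mulVf ?gt_eqF// powRr1.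
  have := tail _ v0; rewrite vu -lee_fin fineK; last first.
    by apply: fin_num_measure; exact: measurable_tail.
  apply: le_trans; apply: le_measure; rewrite ?inE//.
  - have := emeasurable_fun_c_infty measurableT
      (proj2 (measurable_EFinP _ _) mXp) u%:E.
    by rewrite setTI.
  - exact: measurable_tail.
  - move=> w /= uX; rewrite -[leRHS]powRr1//.
    rewrite -[X in (_ <= _ `^ X)%R](divff (lt0r_neq0 p0)).
    by rewrite powRrM; apply: ge0_ler_powR => //; rewrite ?nnegrE ?invr_ge0 ?powR_ge0 ?(ltW p0).
have M0 : 0 <= \int[P]_w (expR (k * `|xi 0%N w| `^ p))%:E.
  by apply: integral_ge0 => w _; rewrite lee_fin expR_ge0.
have Mfin : \int[P]_w (expR (k * `|xi 0%N w| `^ p))%:E \is a fin_num.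
  by rewrite ge0_fin_numE.
have ME := esym (fineK Mfin); move: (fine_ge0 M0) ME.
set M := fine _ => {}M0 ME.
have K0 : (0 <= M * expR k / k)%R by rewrite divr_ge0 ?(ltW k0)// mulr_ge0 ?expR_ge0.
exists (M * expR k / k * A)%R => l r B b l0 b0 young bB.
apply: chernoff_nneseries => // [n|n w|m].
- exact: measurable_funM.
- by rewrite mulr_ge0.
pose F (i : nat) (x : R) := expR (l * a i * `|x|).
have mF i : measurable_fun setT (F i).
  apply: measurableT_comp => //.
  by apply: measurable_funM => //; exact: normr_measurable.
have F0 i x : (0 <= F i x)%R by exact: expR_ge0.
have FE i : \int[P]_w (F i (xi i w))%:E <=
    (expR (b i + M * expR k / k * (l * a i)))%:E.
  rewrite expectation_identically_distributed//.
  apply: (mgf_le_of_young (mabs 0%N) _ p1 k0 ME) => //; first by rewrite mulr_ge0.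
  exact: young.
have Foo i : \int[P]_w (F i (xi i w))%:E < +oo by rewrite (le_lt_trans (FE i)) ?ltry.
have FE0 i : 0 <= \int[P]_w (F i (xi i w))%:E.
  by apply: integral_ge0 => w _; rewrite lee_fin.
have -> : (fun w => (expR (l * \sum_(i < m) (a i * `|xi i w|)))%:E) =
    (fun w => (\prod_(i < m) F i (xi i w))%:E).
  apply/funext => w; rewrite /F -expR_sum mulr_sumr; congr (expR _)%:E.
  by apply: eq_bigr => i _; rewrite mulrA.
rewrite expectation_prod_independent//.
apply: le_trans (lee_prode m FE0 FE) _.
rewrite prodEFin lee_fin -expR_sum ler_expR big_split/= lerD//; first exact: bB.
rewrite -!mulr_sumr -[leRHS]mulrA ler_wpM2l// mulrC ler_wpM2r//; exact: aA.
Qed.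

(** If X_i >= r x_i for all i < m, then already the m-th partial sum is at least r. *)
Lemma lower_tail_bound (p c2 L : R) :
  (forall u, 0 <= u -> expR (- (c2 * u `^ p) - L) <=
    fine (P [set w | (u <= `|xi 0%N w|)%R]))%R ->
  forall (r : R) (m : nat) (x : nat -> R),
    (0 <= r)%R -> (forall i, 0 <= x i)%R -> (1 <= \sum_(i < m) a i * x i)%R ->
  (expR (- (c2 * r `^ p * \sum_(i < m) x i `^ p) - L *+ m))%:E <=
    P [set w | r%:E <= S w].
Proof.
move=> tail r m x r0 x0 ax.
have mB i : measurable [set y : R | (r * x i <= `|y|)%R] by exact: mge.
apply: (@le_trans _ _ (P [set w | forall i, (i < m)%N -> (r * x i <= `|xi i w|)%R])).
  rewrite (independent_prod_preimage m hindep mB).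
  apply: (@le_trans _ _ (\prod_(i < m) (expR (- (c2 * (r * x i) `^ p) - L))%:E)).
    rewrite prodEFin lee_fin -expR_sum ler_expR big_split/= sumrN sumr_const card_ord.
    rewrite mulNrn lerD2r lerN2 mulr_sumr.
    by apply: ler_sum => i _; rewrite powRM// mulrA.
  apply: (@lee_prode _ m (fun i => (expR (- (c2 * (r * x i) `^ p) - L))%:E)
     (fun i => P (xi i @^-1` [set y | (r * x i <= `|y|)%R]))) => i.
    by rewrite lee_fin expR_ge0.
  have -> : P (xi i @^-1` [set y | (r * x i <= `|y|)%R]) =
      P [set w | (r * x i <= `|xi 0%N w|)%R] by exact: tail_identically_distributed.
  rewrite -[leRHS]fineK; first by rewrite lee_fin tail// mulr_ge0.
  by apply: fin_num_measure; exact: measurable_tail.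
apply: le_measure; rewrite ?inE.
- rewrite (_ : [set _ | _] =
    \bigcap_(i in `I_m) (xi i @^-1` [set y | (r * x i <= `|y|)%R])).
    by apply: bigcap_measurableType => i _; exact: measurable_preimage_RV.
  by apply/seteqP; split => w Bw i; apply: Bw.
- exact: measurable_series_tail.
- move=> w /= Bw; apply: (@le_trans _ _ (\sum_(i < m) a i * `|xi i w|)%:E).
    rewrite lee_fin; apply: (@le_trans _ _ (r * \sum_(i < m) a i * x i)%R).
      by rewrite ler_peMr.
    rewrite mulr_sumr; apply: ler_sum => i _.
    by rewrite mulrCA ler_wpM2l// Bw.
  rewrite -sumEFin -(big_mkord xpredT (fun i => (a i * `|xi i w|)%:E)).
  by apply: nneseries_lim_ge => n _ _; rewrite lee_fin mulr_ge0.
Qed.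

End weighted_sums.

(** * The logarithmic asymptotics *)

(** The two bounds force f r to be finite and positive, so that the quotient of
extended reals is eventually a quotient of reals. *)
Lemma asymp_equiv_lne_of_exp_bounds (R : realType) (f : R -> \bar R)
    (p c g : R) : (0 < c)%R -> (0 < g)%R ->
  (forall e : R, (0 < e < 1)%R -> \forall r \near +oo%R,
     (expR (- ((1 + e) * (c * g) * r `^ p)))%:E <= f r <=
     (expR (- ((1 - e) * (c * g) * r `^ p)))%:E) ->
  asymp_equiv_pinfty (fun r => lne (f r)) (fun r => (- (r `^ p) * c * g)%:E).
Proof.
move=> c0 g0 fexp.
have key (e : R) : (0 < e < 1)%R -> \forall r \near +oo%R,
    lne (f r) / (- (r `^ p) * c * g)%:E \is a fin_num /\
    (`|1 - fine (lne (f r) / (- (r `^ p) * c * g)%:E)| <= e)%R.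
  move=> e01; near=> r.
  have r0 : (0 < r)%R by near: r; exact: nbhs_pinfty_gt.
  have rp0 : (0 < r `^ p)%R by rewrite powR_gt0.
  have /andP[fl fu] : (expR (- ((1 + e) * (c * g) * r `^ p)))%:E <= f r <=
     (expR (- ((1 - e) * (c * g) * r `^ p)))%:E by near: r; exact: fexp.
  have ffin : f r \is a fin_num.
    rewrite fin_numElt (lt_le_trans _ fl) ?ltNyr//=.
    by rewrite (le_lt_trans fu) ?ltry.
  move: fl fu; rewrite -(fineK ffin) !lee_fin; set y := fine _ => fl fu.
  have y0 : (0 < y)%R by rewrite (lt_le_trans _ fl)// expR_gt0.
  pose D := (r `^ p * c * g)%R.
  have D0 : (0 < D)%R by rewrite !mulr_gt0.
  have -> : (- (r `^ p) * c * g = - D)%R by rewrite !mulNr.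
  rewrite lne_EFin// inver oppr_eq0 gt_eqF//=; split=> //.
  move: fl fu; rewrite -{1 2}[y]lnK ?posrE// !ler_expR => fl fu.
  rewrite invrN mulrN opprK; set v := (ln y / D)%R.
  have vl : (- (1 + e) <= v)%R.
    rewrite ler_pdivlMr//; apply: le_trans fl.
    by rewrite le_eqVlt; apply/orP; left; apply/eqP; rewrite /D; ring.
  have vu : (v <= - (1 - e))%R.
    rewrite ler_pdivrMr//; apply: le_trans fu _.
    by rewrite le_eqVlt; apply/orP; left; apply/eqP; rewrite /D; ring.
  by rewrite ler_norml; apply/andP; split; lra.
apply: cvg_EFin.
  have h01 : (0 < (2^-1 : R) < 1)%R by rewrite invr_gt0 ltr0n invf_lt1 ?ltr1n ?ltr0n.
  by near=> r; have [] : lne (f r) / (- (r `^ p) * c * g)%:E \is a fin_num /\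
    (`|1 - fine (lne (f r) / (- (r `^ p) * c * g)%:E)| <= 2^-1)%R
    by near: r; exact: key.
apply/cvgrPdist_le => e e0.
pose e' : R := Num.min e 2^-1%R.
have e'01 : (0 < e' < 1)%R.
  rewrite /e' lt_min e0 invr_gt0 ltr0n/=.
  by rewrite gt_min invf_lt1 ?ltr1n ?ltr0n// orbT.
near=> r.
have [_ H] : lne (f r) / (- (r `^ p) * c * g)%:E \is a fin_num /\
    (`|1 - fine (lne (f r) / (- (r `^ p) * c * g)%:E)| <= e')%R
    by near: r; exact: key.
by rewrite /= (le_trans H)// /e' ge_min lexx.
Unshelve. all: by end_near. Qed.

Lemma bounded_of_summable_powers (R : realType) (a : nat -> R) (s : R) :
  (0 < s)%R -> (forall n, 0 < a n)%R ->
  \sum_(0 <= n <oo) (a n `^ s)%:E < +oo ->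
  exists A, forall n, (a n <= A)%R.
Proof.
move=> s0 a0; have as0 n : (0 <= a n `^ s)%R by exact: powR_ge0.
set U := \sum_(0 <= n <oo) _ => Uoo.
have U0 : 0 <= U by apply: nneseries_ge0 => n _ _; rewrite lee_fin.
have Ufin : U \is a fin_num by rewrite ge0_fin_numE.
exists (fine U `^ s^-1)%R => n.
have asU : (a n `^ s <= fine U)%R.
  have UE : U <= (fine U)%:E by rewrite fineK.
  apply: le_trans (proj1 (partial_sum_le_nneseries _ as0) UE n.+1).
  by rewrite big_ord_recr/= lerDr sumr_ge0.
rewrite -[leLHS]powRr1 ?(ltW (a0 n))// -(mulfV (lt0r_neq0 s0)) powRrM.
by apply: ge0_ler_powR asU; rewrite ?nnegrE ?invr_ge0 ?fine_ge0// ltW.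
Qed.

(* Indices are shifted: xi n and a n stand for xi_{n+1} and a_{n+1}.
   The equation on q is in the extended reals, where +oo^-1 = 0 and
   0^-1 = +oo, so p = 1 forces q = +oo and p > 1 forces q = p / (p - 1).
   hconv says that the series of a_n |xi_n| defines a random variable (almost
   surely finite).  It does not follow from ha2q: if a_n = 1 / n and p = 2 then
   the series is almost surely +oo, so the logarithm below is 0. *)
Theorem theorem3p1 (R : realType) (d : measure_display) (T : measurableType d)
    (P : probability T R) (xi : nat -> {RV P >-> R})
    (hindep : mutually_independent xi) (hid : identically_distributed xi)
    (hmean : 'E_P[fun w => `|xi 0%N w|%R] < +oo)
    (p c : R) (hp : (1 <= p)%R) (hc : (0 < c)%R)
    (htail : (fun u : R => (u `^ (- p))%:E
                * lne (P [set w | (u <= `|xi 0%N w|)%R])) @ +oo%R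
             --> (- c)%:E)
    (q : \bar R) (hq : p%:E^-1 + q^-1 = 1)
    (a : nat -> R) (ha : forall n, (0 < a n)%R)
    (ha2q : \sum_(0 <= n <oo) (a n `^ fine (Order.min 2%:E q))%:E < +oo)
    (hconv : {ae P, forall w, \sum_(0 <= n <oo) (a n * `|xi n w|)%:E < +oo}) :
  asymp_equiv_pinfty
    (fun r : R =>
       lne (P [set w | r%:E <= \sum_(0 <= n <oo) (a n * `|xi n w|)%:E]))
    (fun r : R => (- (r `^ p) * c * fine (seq_norm q a) `^ (- p))%:E).
Proof.
have p0 : (0 < p)%R by rewrite (lt_le_trans _ hp).
pose f u := fine (P [set w | (u <= `|xi 0%N w|)%R]).
have ffin u : P [set w | (u <= `|xi 0%N w|)%R] \is a fin_num.
  by apply: fin_num_measure; exact: measurable_tail.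
have f01 u : (0 <= f u <= 1)%R.
  by rewrite fine_ge0 ?measure_ge0//= -lee_fin fineK// probability_le1//;
     exact: measurable_tail.
have fdec u v : (u <= v)%R -> (f v <= f u)%R.
  move=> uv; rewrite -lee_fin !fineK//.
  apply: le_measure; rewrite ?inE; [exact: measurable_tail..|].
  by move=> w /=; exact: le_trans.
have ftail : (fun u : R => (u `^ (- p))%:E * lne (f u)%:E) @ +oo%R --> (- c)%:E.
  rewrite (_ : (fun u : R => _) = (fun u : R => (u `^ (- p))%:E
                * lne (P [set w | (u <= `|xi 0%N w|)%R])))//.
  by apply/funext => u; rewrite /f fineK.
have [upper lower] := tail_exponential_bounds p0 f01 fdec ftail.
have s0 : (0 < fine (Order.min 2%:E q))%R.
  have [[_ ->]|[s [-> _ s1 _]]] := conjugate_exponents hp hq.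
    by rewrite (min_idPl _) ?leey//= ltr0n.
  by rewrite -EFin_min/= lt_min ltr0n (lt_trans _ s1).
have [A' aA'] := bounded_of_summable_powers s0 ha ha2q.
have hpos : 0 < P [set w | (1 <= `|xi 0%N w|)%R].
  have cc1 : (c < c + 1)%R by rewrite ltrDl.
  have [L fL] := lower (c + 1)%R cc1 (addr_gt0 hc ltr01).
  by rewrite -(fineK (ffin _)) lte_fin (lt_le_trans _ (fL 1%R ler01))// expR_gt0.
have [A aA] := summable_weights hindep hid ha aA' hpos hconv.
set N := fine (seq_norm q a).
have N0 : (0 < N)%R.
  have [[_ ?]|[s [? _ s1 _]]] := conjugate_exponents hp hq; subst q.
    by have [] := seq_norm_pinftyP ha aA.
  by have [] := seq_norm_finP ha aA s1.
pose g := (N `^ (- p))%R.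
have g0 : (0 < g)%R by rewrite powR_gt0.
have G0 : (0 < c * g)%R by rewrite mulr_gt0.
apply: (asymp_equiv_lne_of_exp_bounds hc g0) => e /andP[e0 e1].
(* Half of the tolerance e is spent on k < c, the other half on K l, which is of
   smaller order than r^p. *)
have upper_near : \forall r \near +oo%R,
    P [set w | r%:E <= \sum_(0 <= n <oo) (a n * `|xi n w|)%:E] <=
    (expR (- ((1 - e) * (c * g) * r `^ p)))%:E.
  pose k := (c * (1 - e / 2))%R; pose c1 := (c * (1 - e / 4))%R.
  have k0 : (0 < k)%R by rewrite mulr_gt0//; lra.
  have kc1 : (k < c1)%R by rewrite ltr_pM2l//; lra.
  have c10 : (0 < c1 < c)%R.
    by rewrite (lt_trans k0)//= gtr_pMr//; lra.
  have [L fL] := upper c1 c10.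
  have kkc1 : (0 < k < c1)%R by rewrite k0 kc1.
  have [K UB] := upper_tail_bound hindep hid ha hp kkc1 fL aA.
  near=> r.
  have r0 : (0 < r)%R by near: r; exact: nbhs_pinfty_gt.
  have rK : (2 * K * k * p / (e * c) < r)%R.
    by near: r; apply: nbhs_pinfty_gt; exact: num_real.
  have [b [b0 young bB]] := dual_norm_bound ha aA r hp hq.
  rewrite -/N -/g in young bB.
  pose l := (k * (p * r `^ (p - 1) * g))%R.
  have l0 : (0 <= l)%R.
    by apply: (mulr_ge0 (ltW k0)); rewrite !mulr_ge0 ?powR_ge0 ?(ltW p0) ?(ltW g0).
  have kb0 n : (0 <= k * b n)%R by rewrite mulr_ge0 ?(ltW k0).
  have kyoung n (x : R) : (0 <= x -> l * a n * x <= k * x `^ p + k * b n)%R.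
    move=> x0.
    have -> : (l * a n * x = k * (p * r `^ (p - 1) * g * a n * x))%R.
      by rewrite /l; ring.
    rewrite -mulrDr ler_wpM2l ?(ltW k0)//; exact: young.
  have kbB m : (\sum_(i < m) k * b i <= k * ((p - 1) * r `^ p * g))%R.
    by rewrite -mulr_sumr ler_wpM2l ?(ltW k0).
  apply: le_trans (UB l r _ _ l0 kb0 kyoung kbB) _.
  rewrite lee_fin ler_expR /l.
  have rp : (r `^ p = r * r `^ (p - 1))%R by rewrite mulr_powRB1// ltW.
  rewrite ltr_pdivrMr ?mulr_gt0// in rK.
  set z := (r `^ (p - 1))%R in rp *; have z0 : (0 <= z)%R by exact: powR_ge0.
  rewrite rp -subr_ge0.
  have -> : (- ((1 - e) * (c * g) * (r * z)) -
     (k * ((p - 1) * (r * z) * g) + K * (k * (p * z * g)) - k * (p * z * g) * r) =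
     2^-1 * (g * z) * (r * (e * c) - 2 * K * k * p))%R.
    by rewrite /k; field.
  by rewrite !mulr_ge0 ?invr_ge0// ?subr_ge0 ?(ltW g0) ?(ltW rK).
(* A quarter of the tolerance e is spent on each of c2 > c, t > g and the constant
   L *+ m; the product of the first two leaves the second order term e ^+ 2 / 16. *)
have lower_near : \forall r \near +oo%R,
    (expR (- ((1 + e) * (c * g) * r `^ p)))%:E <=
    P [set w | r%:E <= \sum_(0 <= n <oo) (a n * `|xi n w|)%:E].
  pose c2 := (c * (1 + e / 4))%R; pose t := (g * (1 + e / 4))%R.
  have c20 : (0 < c2)%R by rewrite mulr_gt0//; lra.
  have cc2 : (c < c2)%R by rewrite ltr_pMr//; lra.
  have gt : (g < t)%R by rewrite ltr_pMr//; lra.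
  have [L fL] := lower c2 cc2 c20.
  have [m [x [x0 ax xt]]] := primal_norm_witness ha aA hp hq gt.
  near=> r.
  have r1 : (1 <= r)%R by near: r; exact: nbhs_pinfty_ge.
  have r0 : (0 <= r)%R by rewrite (le_trans _ r1).
  have rL : (4 * (L *+ m) / (e * (c * g)) <= r)%R.
    by near: r; apply: nbhs_pinfty_ge; exact: num_real.
  apply: le_trans (lower_tail_bound hindep hid ha fL r0 x0 ax).
  rewrite lee_fin ler_expR.
  rewrite ler_pdivrMr ?mulr_gt0// in rL.
  set V := (L *+ m)%R in rL *; set X := (\sum_(i < m) _)%R in xt *.
  have rp : (r <= r `^ p)%R by exact: le1r_powR.
  set z := (r `^ p)%R in rp *.
  have z0 : (0 <= z)%R by exact: le_trans rp.
  have H1 : (c2 * z * X <= c2 * z * t)%R by rewrite ler_wpM2l// mulr_ge0// ltW.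
  have H2 : (4 * V <= z * (e * (c * g)))%R.
    by rewrite (le_trans rL)// ler_wpM2r// mulr_ge0 ?(ltW e0)// ltW.
  have H3 : (0 <= c * g * z * (e * (1 - e)))%R.
    by rewrite !mulr_ge0 ?subr_ge0 ?(ltW e1) ?(ltW e0) ?(ltW hc) ?(ltW g0).
  have H4 : (0 <= c * g * z * e)%R by rewrite !mulr_ge0 ?(ltW e0) ?(ltW hc) ?(ltW g0).
  have H5 : (c2 * z * t = c * g * z + 2^-1 * (c * g * z * e) +
      16^-1 * (c * g * z * (e * e)))%R.
    by rewrite /c2 /t; field.
  rewrite -subr_ge0; move: H1 H2 H3 H4; rewrite H5; nra.
near=> r; apply/andP; split; near: r.
- exact: lower_near.
- exact: upper_near.
Unshelve. all: by end_near. Qed.
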